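(* $\mathbf{BorelStoch}$ cannot be embedded in any traced monoidal category: there is no traced symmetric monoidal category $\mathbf D$ admitting a faithful strong symmetric monoidal functor $\mathbf{BorelStoch}\to\mathbf D$.
   Context: $\mathbf{BorelStoch}$ is the category whose objects are standard Borel spaces and whose morphisms $X\to Y$ are Markov kernels $p : X\times\Sigma_Y\to[0,1]$, with composition $(gf)(x,E)=\int g(y,E)\,f(x,\mathrm dy)$. It is symmetric monoidal with $\otimes$ the product of spaces on objects and product of measures on kernels, and unit the one-point space. A traced monoidal category is a symmetric monoidal category $\mathbf D$ with operators $\mathbf{tr}^W_{X,Y} : \mathbf D(X\otimes W,Y\otimes W)\to\mathbf D(X,Y)$ satisfying (suppressing coherence isomorphisms): tightening, $\mathbf{tr}^W((h\otimes\mathrm{id}_W)\circ f\circ(g\otimes \mathrm{id}_W))=h\circ\mathbf{tr}^W(f)\circ g$; sliding, $\mathbf{tr}^W((\mathrm{id}_Y\otimes g)\circ f)=\mathbf{tr}^{W'}(f\circ(\mathrm{id}_X\otimes g))$ for $f:X\otimes W\to Y\otimes W'$ and $g:W'\to W$; vanishing, $\mathbf{tr}^I(f)=f$; associativity, $\mathbf{tr}^{U\otimes V}(f)=\mathbf{tr}^U(\mathbf{tr}^V(f))$; superposition, $\mathbf{tr}^W(g\otimes f)=g\otimes\mathbf{tr}^W(f)$; yanking, $\mathbf{tr}^W(\mathrm{swap}_{W,W})=\mathrm{id}_W$. *)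

(* Defs.v *)
From HB Require Import structures.
From mathcomp Require Import all_boot all_order all_algebra.
From mathcomp Require Import all_classical all_reals all_analysis.
From mathcomp Require Import measurable_realfun giry.

Set Implicit Arguments.
Unset Strict Implicit.
Unset Printing Implicit Defensive.
Import Order.TTheory GRing.Theory Num.Theory.
Import numFieldNormedType.Exports.

Declare Scope cat_scope.
Delimit Scope cat_scope with cat.

Reserved Notation "f ≈ g" (at level 70, no associativity).
Reserved Notation "g ∘ f" (at level 40, left associativity).
Reserved Notation "X ⊗ Y" (at level 38, left associativity).
Reserved Notation "f ⊗₁ g" (at level 38, left associativity).

(* Equality of morphisms is a given equivalence relation on each type of
   morphisms, so that kernels can be compared on measurable sets only: the
   library's measures are functions on all sets, unconstrained on the
   non-measurable ones. *)
Record category := Category {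
  obj :> Type;
  mor : obj -> obj -> Type;
  eqh : forall X Y, mor X Y -> mor X Y -> Prop;
  idh : forall X, mor X X;
  comph : forall X Y Z, mor Y Z -> mor X Y -> mor X Z;
  eqh_refl : forall X Y (f : mor X Y), eqh f f;
  eqh_sym : forall X Y (f g : mor X Y), eqh f g -> eqh g f;
  eqh_trans : forall X Y (f g h : mor X Y), eqh f g -> eqh g h -> eqh f h;
  eqh_comp : forall X Y Z (g g' : mor Y Z) (f f' : mor X Y),
    eqh g g' -> eqh f f' -> eqh (comph g f) (comph g' f');
  comp1h : forall X Y (f : mor X Y), eqh (comph (idh Y) f) f;
  comph1 : forall X Y (f : mor X Y), eqh (comph f (idh X)) f;
  comphA : forall X Y Z W (h : mor Z W) (g : mor Y Z) (f : mor X Y),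
    eqh (comph h (comph g f)) (comph (comph h g) f) }.

Arguments mor {c} X Y.
Arguments eqh {c X Y} f g.
Arguments idh {c} X.
Arguments comph {c X Y Z} g f.
Notation "f ≈ g" := (eqh f g) : cat_scope.
Notation "g ∘ f" := (comph g f) : cat_scope.
Local Open Scope cat_scope.

Definition inverses (C : category) (X Y : C) (f : mor X Y) (g : mor Y X) :=
  g ∘ f ≈ idh X /\ f ∘ g ≈ idh Y.

Record symmon := SymMon {
  symmon_cat :> category;
  unito : symmon_cat;
  tenso : symmon_cat -> symmon_cat -> symmon_cat;
  tensh : forall X X' Y Y' : symmon_cat, mor X X' -> mor Y Y' ->
    mor (tenso X Y) (tenso X' Y');
  asso : forall X Y Z : symmon_cat,
    mor (tenso (tenso X Y) Z) (tenso X (tenso Y Z));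
  assoV : forall X Y Z : symmon_cat,
    mor (tenso X (tenso Y Z)) (tenso (tenso X Y) Z);
  lunit : forall X : symmon_cat, mor (tenso unito X) X;
  lunitV : forall X : symmon_cat, mor X (tenso unito X);
  runit : forall X : symmon_cat, mor (tenso X unito) X;
  runitV : forall X : symmon_cat, mor X (tenso X unito);
  swaph : forall X Y : symmon_cat, mor (tenso X Y) (tenso Y X);
  eqh_tens : forall (X X' Y Y' : symmon_cat)
      (f f' : mor X X') (g g' : mor Y Y'),
    f ≈ f' -> g ≈ g' -> tensh f g ≈ tensh f' g';
  tensh1 : forall X Y : symmon_cat,
    tensh (idh X) (idh Y) ≈ idh (tenso X Y);
  tensh_comp : forall (X X' X'' Y Y' Y'' : symmon_cat)
      (f' : mor X' X'') (f : mor X X') (g' : mor Y' Y'') (g : mor Y Y'),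
    tensh (f' ∘ f) (g' ∘ g) ≈ tensh f' g' ∘ tensh f g;
  assoK : forall X Y Z, inverses (asso X Y Z) (assoV X Y Z);
  lunitK : forall X, inverses (lunit X) (lunitV X);
  runitK : forall X, inverses (runit X) (runitV X);
  asso_nat : forall (X X' Y Y' Z Z' : symmon_cat)
      (f : mor X X') (g : mor Y Y') (h : mor Z Z'),
    asso X' Y' Z' ∘ tensh (tensh f g) h ≈ tensh f (tensh g h) ∘ asso X Y Z;
  lunit_nat : forall (X Y : symmon_cat) (f : mor X Y),
    lunit Y ∘ tensh (idh unito) f ≈ f ∘ lunit X;
  runit_nat : forall (X Y : symmon_cat) (f : mor X Y),
    runit Y ∘ tensh f (idh unito) ≈ f ∘ runit X;
  swaph_nat : forall (X X' Y Y' : symmon_cat) (f : mor X X') (g : mor Y Y'),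
    swaph X' Y' ∘ tensh f g ≈ tensh g f ∘ swaph X Y;
  pentagon_law : forall W X Y Z : symmon_cat,
    asso W X (tenso Y Z) ∘ asso (tenso W X) Y Z ≈
    tensh (idh W) (asso X Y Z) ∘ asso W (tenso X Y) Z
      ∘ tensh (asso W X Y) (idh Z);
  triangle_law : forall X Y : symmon_cat,
    tensh (idh X) (lunit Y) ∘ asso X unito Y ≈ tensh (runit X) (idh Y);
  hexagon_law : forall X Y Z : symmon_cat,
    asso Y Z X ∘ swaph X (tenso Y Z) ∘ asso X Y Z ≈
    tensh (idh Y) (swaph X Z) ∘ asso Y X Z ∘ tensh (swaph X Y) (idh Z);
  swaphK : forall X Y : symmon_cat,
    swaph Y X ∘ swaph X Y ≈ idh (tenso X Y) }.

Arguments unito {s}.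
Arguments tenso {s} X Y.
Arguments tensh {s X X' Y Y'} f g.
Arguments asso {s} X Y Z.
Arguments assoV {s} X Y Z.
Arguments lunit {s} X.
Arguments lunitV {s} X.
Arguments runit {s} X.
Arguments runitV {s} X.
Arguments swaph {s} X Y.
Notation "X ⊗ Y" := (tenso X Y) : cat_scope.
Notation "f ⊗₁ g" := (tensh f g) : cat_scope.

Record traced := Traced {
  traced_symmon :> symmon;
  tr : forall W X Y : traced_symmon, mor (X ⊗ W) (Y ⊗ W) -> mor X Y;
  eqh_tr : forall (W X Y : traced_symmon) (f g : mor (X ⊗ W) (Y ⊗ W)),
    f ≈ g -> tr f ≈ tr g;
  tr_tightening : forall (W X X' Y Y' : traced_symmon)
      (g : mor X' X) (f : mor (X ⊗ W) (Y ⊗ W)) (h : mor Y Y'),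
    tr ((h ⊗₁ idh W) ∘ f ∘ (g ⊗₁ idh W)) ≈ h ∘ tr f ∘ g;
  tr_sliding : forall (W W' X Y : traced_symmon)
      (f : mor (X ⊗ W) (Y ⊗ W')) (g : mor W' W),
    tr ((idh Y ⊗₁ g) ∘ f) ≈ tr (f ∘ (idh X ⊗₁ g));
  tr_vanishing : forall (X Y : traced_symmon) (f : mor (X ⊗ unito) (Y ⊗ unito)),
    tr f ≈ runit Y ∘ f ∘ runitV X;
  tr_associativity : forall (U V X Y : traced_symmon)
      (f : mor (X ⊗ (U ⊗ V)) (Y ⊗ (U ⊗ V))),
    tr f ≈ tr (tr (assoV Y U V ∘ f ∘ asso X U V));
  tr_superposition : forall (W X X' Y Y' : traced_symmon)
      (g : mor X Y) (f : mor (X' ⊗ W) (Y' ⊗ W)),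
    tr (assoV Y Y' W ∘ (g ⊗₁ f) ∘ asso X X' W) ≈ g ⊗₁ tr f;
  tr_yanking : forall W : traced_symmon, tr (swaph W W) ≈ idh W }.

(* Strong symmetric monoidal functors; fmuV and fepsV are the inverses of the
   structure isomorphisms fmu and feps. *)
Record symmon_functor (C D : symmon) := SymMonFunctor {
  fobj :> C -> D;
  fmor : forall X Y : C, mor X Y -> mor (fobj X) (fobj Y);
  eqh_fmor : forall (X Y : C) (f g : mor X Y), f ≈ g -> fmor f ≈ fmor g;
  fmor1 : forall X : C, fmor (idh X) ≈ idh (fobj X);
  fmor_comp : forall (X Y Z : C) (g : mor Y Z) (f : mor X Y),
    fmor (g ∘ f) ≈ fmor g ∘ fmor f;
  fmu : forall X Y : C, mor (fobj X ⊗ fobj Y) (fobj (X ⊗ Y));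
  fmuV : forall X Y : C, mor (fobj (X ⊗ Y)) (fobj X ⊗ fobj Y);
  feps : mor unito (fobj unito);
  fepsV : mor (fobj unito) unito;
  fmuK : forall X Y, inverses (fmu X Y) (fmuV X Y);
  fepsK : inverses feps fepsV;
  fmu_nat : forall (X X' Y Y' : C) (f : mor X X') (g : mor Y Y'),
    fmu X' Y' ∘ (fmor f ⊗₁ fmor g) ≈ fmor (f ⊗₁ g) ∘ fmu X Y;
  fmu_asso : forall X Y Z : C,
    fmor (asso X Y Z) ∘ fmu (X ⊗ Y) Z ∘ (fmu X Y ⊗₁ idh (fobj Z)) ≈
    fmu X (Y ⊗ Z) ∘ (idh (fobj X) ⊗₁ fmu Y Z)
      ∘ asso (fobj X) (fobj Y) (fobj Z);
  fmu_lunit : forall X : C,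
    fmor (lunit X) ∘ fmu unito X ∘ (feps ⊗₁ idh (fobj X)) ≈ lunit (fobj X);
  fmu_runit : forall X : C,
    fmor (runit X) ∘ fmu X unito ∘ (idh (fobj X) ⊗₁ feps) ≈ runit (fobj X);
  fmu_swaph : forall X Y : C,
    fmor (swaph X Y) ∘ fmu X Y ≈ fmu Y X ∘ swaph (fobj X) (fobj Y) }.

Arguments fmor {C D} s {X Y} f.

Definition faithful_functor (C D : symmon) (F : symmon_functor C D) :=
  forall (X Y : C) (f g : mor X Y), fmor F f ≈ fmor F g -> f ≈ g.

(* Adjoins an object None playing the part of the empty space: there is exactly
   one morphism from None to each object, there is none to None from any other
   object, and a tensor product with a factor None is None. *)
Section AdjoinEmpty.
Variable C : symmon.

Definition emhom (X Y : option C) : Type :=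
  match X, Y with
  | None, _ => unit
  | Some _, None => Empty_set
  | Some X, Some Y => mor X Y
  end.

Definition emeq (X Y : option C) : emhom X Y -> emhom X Y -> Prop :=
  match X, Y with
  | Some X, Some Y => fun f g => f ≈ g
  | _, _ => fun _ _ => True
  end.

Definition emid (X : option C) : emhom X X :=
  if X is Some X then idh X else tt.

Definition emcomp (X Y Z : option C) :
    emhom Y Z -> emhom X Y -> emhom X Z :=
  match X, Y, Z with
  | None, _, _ => fun _ _ => tt
  | Some _, None, _ => fun _ f => match f with end
  | Some _, Some _, None => fun g _ => match g with end
  | Some _, Some _, Some _ => fun g f => g ∘ f
  end.

Definition adjoin_empty_cat : category.
Proof.
refine (@Category (option C) emhom emeq emid emcomp _ _ _ _ _ _ _).
- by move=> [X|] [Y|] //=; exact: eqh_refl.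
- by move=> [X|] [Y|] //=; exact: eqh_sym.
- by move=> [X|] [Y|] //=; exact: eqh_trans.
- by move=> [X|] [Y|] [Z|] //=; exact: eqh_comp.
- by move=> [X|] [Y|] //=; exact: comp1h.
- by move=> [X|] [Y|] //=; exact: comph1.
- by move=> [X|] [Y|] [Z|] [W|] //=; exact: comphA.
Defined.

Definition emtenso (X Y : option C) : option C :=
  match X, Y with Some X, Some Y => Some (X ⊗ Y) | _, _ => None end.

Definition emtensh (X X' Y Y' : option C) :
    emhom X X' -> emhom Y Y' -> emhom (emtenso X Y) (emtenso X' Y') :=
  match X, X', Y, Y' with
  | None, _, _, _ => fun _ _ => tt
  | Some _, _, None, _ => fun _ _ => tt
  | Some _, None, Some _, _ => fun f _ => match f with end
  | Some _, Some _, Some _, None => fun _ g => match g with end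
  | Some _, Some _, Some _, Some _ => fun f g => f ⊗₁ g
  end.

Definition emasso (X Y Z : option C) :
    emhom (emtenso (emtenso X Y) Z) (emtenso X (emtenso Y Z)) :=
  match X, Y, Z with
  | Some X, Some Y, Some Z => asso X Y Z | _, _, _ => tt end.

Definition emassoV (X Y Z : option C) :
    emhom (emtenso X (emtenso Y Z)) (emtenso (emtenso X Y) Z) :=
  match X, Y, Z with
  | Some X, Some Y, Some Z => assoV X Y Z | _, _, _ => tt end.

Definition emlunit (X : option C) : emhom (emtenso (Some unito) X) X :=
  if X is Some X then lunit X else tt.

Definition emlunitV (X : option C) : emhom X (emtenso (Some unito) X) :=
  if X is Some X then lunitV X else tt.

Definition emrunit (X : option C) : emhom (emtenso X (Some unito)) X :=
  if X is Some X then runit X else tt.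

Definition emrunitV (X : option C) : emhom X (emtenso X (Some unito)) :=
  if X is Some X then runitV X else tt.

Definition emswaph (X Y : option C) : emhom (emtenso X Y) (emtenso Y X) :=
  match X, Y with Some X, Some Y => swaph X Y | _, _ => tt end.

Definition adjoin_empty : symmon.
Proof.
refine (@SymMon adjoin_empty_cat (Some unito) emtenso emtensh
  emasso emassoV emlunit emlunitV emrunit emrunitV emswaph
  _ _ _ _ _ _ _ _ _ _ _ _ _ _).
- by move=> [X|] [X'|] [Y|] [Y'|] //=; exact: eqh_tens.
- by move=> [X|] [Y|] //=; exact: tensh1.
- by move=> [X|] [X'|] [X''|] [Y|] [Y'|] [Y''|] //=; exact: tensh_comp.
- by move=> [X|] [Y|] [Z|] //=; exact: assoK.
- by move=> [X|] //=; exact: lunitK.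
- by move=> [X|] //=; exact: runitK.
- by move=> [X|] [X'|] [Y|] [Y'|] [Z|] [Z'|] //=; exact: asso_nat.
- by move=> [X|] [Y|] //=; exact: lunit_nat.
- by move=> [X|] [Y|] //=; exact: runit_nat.
- by move=> [X|] [X'|] [Y|] [Y'|] //=; exact: swaph_nat.
- by move=> [W|] [X|] [Y|] [Z|] //=; exact: pentagon_law.
- by move=> [X|] [Y|] //=; exact: triangle_law.
- by move=> [X|] [Y|] [Z|] //=; exact: hexagon_law.
- by move=> [X|] [Y|] //=; exact: swaphK.
Defined.

End AdjoinEmpty.

Local Open Scope classical_set_scope.
Local Open Scope ring_scope.

HB.instance Definition _ (T U : puniformType) := Pointed.on (T * U)%type.

Section ProdComplete.
Context (T U : completeType).

Lemma prod_complete (F : set_system (T * U)) :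
  ProperFilter F -> cauchy F -> cvg F.
Proof.
move=> FF Fc.
have c1 : cauchy (fst @ F).
  move=> A entA; rewrite near_simpl -near2E near_map2.
  apply: Fc; exists (A, setT) => /=; first by split => //; exact: filterT.
  by move=> [[a b] [c d]] [/= Aab _]; exists ((a, c), (b, d)).
have c2 : cauchy (snd @ F).
  move=> A entA; rewrite near_simpl -near2E near_map2.
  apply: Fc; exists (setT, A) => /=; first by split => //; exact: filterT.
  by move=> [[a b] [c d]] [/= _ Acd]; exists ((a, c), (b, d)).
have Ft : fst @ F --> lim (fst @ F) by apply: cauchy_cvg.
have Fu : snd @ F --> lim (snd @ F) by apply: cauchy_cvg.
apply/cvg_ex; exists (lim (fst @ F), lim (snd @ F)) => /=.
rewrite -[F in F --> _](_ : (fun x => (x.1, x.2)) @ F = F).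
  by apply: cvg_pair => //; exact: nbhs_filter.
by rewrite (_ : (fun x : T * U => (x.1, x.2)) = id)//; apply/funext => -[].
Qed.

HB.instance Definition _ := Uniform_isComplete.Build (T * U)%type prod_complete.
End ProdComplete.

HB.instance Definition _ (R : numDomainType) (P Q : completePseudoMetricType R) :=
  Complete.on (P * Q)%type.

Section StandardBorel.
Variable R : realType.

Definition borel (P : topologicalType) : set (set P) := <<s @open P >>.

Arguments borel {P}.

(* T is isomorphic, as a measurable space, to the Borel space of a Polish space. *)
Definition standard_borel d (T : measurableType d) :=
  exists (P : completePseudoMetricType R) (f : T -> P),
  [/\ hausdorff_space P, exists2 D : set P, countable D & dense D,
      bijective f &
      forall B : set P, borel B <-> measurable (f @^-1` B)].

Lemma dense_seq (P : ptopologicalType) (D : set P) : countable D -> dense D ->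
  exists u : nat -> P, forall U, open U -> U !=set0 -> exists n, U (u n).
Proof.
move=> /pcard_surjP[u uD] dD; exists u => U oU U0.
have [x [Ux Dx]] := dD U U0 oU.
by have [n _ ux] := uD x Dx; exists n; rewrite ux.
Qed.

Lemma borel_preimage (P Q : topologicalType) (f : P -> Q) (B : set Q) :
  continuous f -> borel B -> borel (f @^-1` B).
Proof.
move=> cf; suff : borel `<=` image_set_system setT f (@borel P).
  by move=> /[apply]; rewrite /image_set_system/= setTI.
apply: smallest_sub.
  by apply: sigma_algebra_image; exact: smallest_sigma_algebra.
move=> U oU; rewrite /image_set_system/= setTI; apply: sub_sigma_algebra.
by apply: open_comp => // x _; exact: cf.
Qed.

Lemma ball_dense (P : completePseudoMetricType R) (u : nat -> P) (p : P) (e : R) :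
  (forall U, open U -> U !=set0 -> exists n, U (u n)) -> 0 < e ->
  exists i, (ball (u i) e)° p /\ (ball (u i) e)° `<=` ball p (e + e).
Proof.
move=> du e0.
have e20 : 0 < e / 2 by rewrite divr_gt0.
have [] := du (ball p (e / 2))° (open_interior _).
  by exists p; apply: nbhsx_ballx.
move=> i /interior_subset pui; exists i; split.
  apply/nbhs_ballP; exists (e / 2) => //= z pz.
  by rewrite (splitr e); apply: ball_triangle pz; exact: ball_sym.
move=> z /interior_subset uz; apply: (ball_triangle (y := u i)) uz.
by apply: le_ball pui; rewrite ler_pdivrMr// ler_peMr ?ler1n// ltW.
Qed.

Lemma standard_borel_prod d d' (T : measurableType d) (T' : measurableType d') :
  standard_borel T -> standard_borel T' -> standard_borel (T * T')%type.
Proof.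
move=> [P [f [hP [D cD dD] [f' fK f'K] mf]]].
move=> [Q [g [hQ [E cE dE] [g' gK g'K] mg]]].
have [u du] := dense_seq cD dD.
have [v dv] := dense_seq cE dE.
pose F (x : T * T') : P * Q := (f x.1, g x.2).
pose G (x : P * Q) : T * T' := (f' x.1, g' x.2).
have FK : cancel F G by move=> [x y]; rewrite /F/G/= fK gK.
have GK : cancel G F by move=> [x y]; rewrite /F/G/= f'K g'K.
pose rect n i j : set (P * Q) :=
  (ball (u i) n.+1%:R^-1)° `*` (ball (v j) n.+1%:R^-1)°.
have rectP (U : set (P * Q)) z : open U -> U z ->
    exists n i j, rect n i j z /\ rect n i j `<=` U.
  move=> oU Uz; have /nbhs_ballP[e /= e0 zeU] : nbhs z U by exact: open_nbhs_nbhs.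
  have e20 : 0 < e / 2 by rewrite divr_gt0.
  pose n := Num.truncn (e / 2)^-1.
  have ne : n.+1%:R^-1 < e / 2.
    rewrite -[ltRHS]invrK ltf_pV2 ?posrE ?invr_gt0//.
    have /truncn_itv/andP[_] : 0 <= (e / 2)^-1 by rewrite invr_ge0 ltW.
    by [].
  have n0 : 0 < n.+1%:R^-1 :> R by rewrite invr_gt0.
  have nne : n.+1%:R^-1 + n.+1%:R^-1 <= e by rewrite (splitr e) lerD// ltW.
  have [i [zi iU]] := ball_dense z.1 du n0.
  have [j [zj jU]] := ball_dense z.2 dv n0.
  exists n, i, j; split => // w [wi wj]; apply: zeU; split.
    by apply: le_ball (iU _ wi).
  by apply: le_ball (jU _ wj).
exists ((P * Q)%type : completePseudoMetricType R), F; split.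
- move=> [p q] [p' q'] /= pq; congr pair.
    apply: hP => A B pA p'B.
    have [] := pq (A `*` setT) (B `*` setT).
    + by exists (A, setT) => //; split => //; exact: filterT.
    + by exists (B, setT) => //; split => //; exact: filterT.
    by move=> [a b] /= [[? _] [? _]]; exists a.
  apply: hQ => A B pA p'B.
  have [] := pq (setT `*` A) (setT `*` B).
  + by exists (setT, A) => //; split => //; exact: filterT.
  + by exists (setT, B) => //; split => //; exact: filterT.
  by move=> [a b] /= [[_ ?] [_ ?]]; exists b.
- exists (D `*` E); first exact: countableX.
  move=> U [[p q] Upq] oU.
  have [[A B] /= [Ap Bq] ABU] : nbhs (p, q) U by exact: open_nbhs_nbhs.
  have [a [Aa Da]] := dD A° (ex_intro _ p Ap) (open_interior _).
  have [b [Bb Eb]] := dE B° (ex_intro _ q Bq) (open_interior _).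
  exists (a, b); split => //; apply: ABU; split => /=; exact: interior_subset.
- by exists G.
- move=> B; split.
    move: B; suff : @borel (P * Q)%type `<=` image_set_system setT F measurable.
      by move=> BF B /BF; rewrite /image_set_system/= setTI.
    apply: smallest_sub.
      by apply: sigma_algebra_image; exact: sigma_algebra_measurable.
    move=> U oU; rewrite /image_set_system/= setTI.
    have -> : U = \bigcup_n \bigcup_i \bigcup_j
        (if `[< rect n i j `<=` U >] then rect n i j else set0).
      apply/seteqP; split => [z Uz|z [n _ [i _ [j _]]]]; last first.
        by case: ifPn => // /asboolP; exact.
      have [n [i [j [zr rU]]]] := rectP U z oU Uz.
      by exists n => //; exists i => //; exists j => //; rewrite asboolT.
    rewrite preimage_bigcup; apply: bigcupT_measurable => n.
    rewrite preimage_bigcup; apply: bigcupT_measurable => i.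
    rewrite preimage_bigcup; apply: bigcupT_measurable => j.
    case: ifPn => _; last by rewrite preimage_set0.
    rewrite (_ : F @^-1` _ = (f @^-1` (ball (u i) n.+1%:R^-1)°) `*`
      (g @^-1` (ball (v j) n.+1%:R^-1)°))//.
    apply: measurableX.
      by apply: (mf _).1; apply: sub_sigma_algebra; exact: open_interior.
    by apply: (mg _).1; apply: sub_sigma_algebra; exact: open_interior.
  suff HG : measurable `<=` image_set_system setT G (@borel (P * Q)%type).
    move=> /HG; rewrite /image_set_system/= setTI -comp_preimage.
    by rewrite (_ : F \o G = id)//; apply/funext.
  apply: smallest_sub.
    by apply: sigma_algebra_image; exact: smallest_sigma_algebra.
  move=> _ [[A mA <-]|[A mA <-]]; rewrite /image_set_system/= !setTI.
    apply: (@borel_preimage _ _ fst (f' @^-1` A)).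
      by move=> z; exact: cvg_fst.
    apply: (mf _).2; rewrite -comp_preimage (_ : f' \o f = id)//; exact/funext.
  apply: (@borel_preimage _ _ snd (g' @^-1` A)).
    by move=> z; exact: cvg_snd.
  apply: (mg _).2; rewrite -comp_preimage (_ : g' \o g = id)//; exact/funext.
Qed.

Lemma standard_borel_unit : standard_borel unit.
Proof.
pose P : completePseudoMetricType R := 'M[R]_(0, 0).
have P0 (p q : P) : p = q by apply/matrixP => -[].
exists P, (fun _ => 0 : 'M[R]_(0,0)); split.
- by move=> p q _; exact: P0.
- exists setT; last by move=> U [x Ux] _; exists x.
  rewrite (_ : setT = [set (0 : 'M[R]_(0,0)) : P]); first exact: countable1.
  by apply/seteqP; split => // x _; exact: P0.
- by exists (fun _ => tt) => [[]|p]//; exact: P0.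
- move=> B; split => // _.
  have [->|/set0P[x Bx]] := eqVneq B set0; first exact: sigma_algebra0.
  rewrite (_ : B = setT); first by apply: sub_sigma_algebra; exact: openT.
  by apply/seteqP; split => // y _; rewrite (P0 y x).
Qed.

End StandardBorel.

Local Open Scope ereal_scope.

Section KernelProbability.
Context d d' (X : measurableType d) (Y : measurableType d') (R : realType).
Variable k : R.-pker X ~> Y.

Definition kprob (x : X) : set Y -> \bar R := k x.
HB.instance Definition _ x := Measure.on (kprob x).
HB.instance Definition _ x :=
  Measure_isProbability.Build _ _ _ (kprob x) (@prob_kernel _ _ _ _ _ k x).
Definition kernel_probability (x : X) : probability Y R := kprob x.

Lemma measurable_kernel_probability :
  measurable_fun [set: X] (fun x => kernel_probability x : giry Y R).
Proof.
apply: measurable_giry_codensity => // B mB.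
exact: (measurable_kernel k B mB).
Qed.
End KernelProbability.

Section KernelComp.
Context d d' d'' (X : measurableType d) (Y : measurableType d')
  (Z : measurableType d'') (R : realType).
Variables (f : R.-pker X ~> Y) (g : R.-pker Y ~> Z).

Let kcomp_setT x : mkcomp_noparam f g x [set: Z] = 1.
Proof.
rewrite /mkcomp_noparam/= /kcomp_noparam.
under eq_integral do rewrite prob_kernel.
by rewrite integral_cst// mul1e prob_kernel.
Qed.

HB.instance Definition _ :=
  Kernel_isProbability.Build _ _ _ _ _ (mkcomp_noparam f g) kcomp_setT.

(* First f, then g. *)
Definition kernel_comp : R.-pker X ~> Z := mkcomp_noparam f g.

End KernelComp.

Section KernelTensor.
Context d1 d2 d3 d4 (X : measurableType d1) (X' : measurableType d2)
  (Y : measurableType d3) (Y' : measurableType d4) (R : realType).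
Variables (f : R.-pker X ~> X') (g : R.-pker Y ~> Y').

Definition ktens (p : X * Y) : {measure set (X' * Y') -> \bar R} :=
  kernel_probability f p.1 \x kernel_probability g p.2.

Let ktens_kernel U : measurable U -> measurable_fun [set: X * Y] (ktens ^~ U).
Proof.
move=> mU.
apply: (@measurableT_comp _ _ _ _ _ _ (giry_ev ^~ U) _
  (fun p : X * Y => giry_prod (kernel_probability f p.1 : giry X' R,
                               kernel_probability g p.2 : giry Y' R))).
  exact: measurable_giry_ev.
apply: (measurableT_comp measurable_giry_prod).
apply: measurable_fun_pair.
- exact: (measurableT_comp (measurable_kernel_probability f)).
- exact: (measurableT_comp (measurable_kernel_probability g)).
Qed.

HB.instance Definition _ := isKernel.Build _ _ _ _ _ ktens ktens_kernel.

Let ktens_setT p : ktens p [set: X' * Y'] = 1.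
Proof. exact: probability_setT. Qed.

HB.instance Definition _ :=
  Kernel_isProbability.Build _ _ _ _ _ ktens ktens_setT.

Definition kernel_tens : R.-pker (X * Y)%type ~> (X' * Y')%type := ktens.

Lemma kernel_tensE p A B : measurable A -> measurable B ->
  kernel_tens p (A `*` B) = f p.1 A * g p.2 B.
Proof. by move=> mA mB; rewrite [LHS]product_measure1E. Qed.

Lemma kernel_tens_section p U :
  kernel_tens p U = \int[f p.1]_x g p.2 (xsection U x).
Proof. by []. Qed.

Lemma kernel_tens_unique p (m : {measure set (X' * Y') -> \bar R}) :
  (forall A B, measurable A -> measurable B ->
    m (A `*` B) = f p.1 A * g p.2 B) ->
  forall U, measurable U -> m U = kernel_tens p U.
Proof.
by move=> mE U mU; apply/esym/product_measure_unique => //.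
Qed.

Lemma integral_kernel_tens p (h : X' * Y' -> \bar R) :
  measurable_fun setT h -> (forall z, 0 <= h z) ->
  \int[kernel_tens p]_z h z = \int[f p.1]_x \int[g p.2]_y h (x, y).
Proof. by move=> mh h0; exact: fubini_tonelli1. Qed.

End KernelTensor.

Section KernelDet.
Context (R : realType).

Definition kernel_det d d' (X : measurableType d) (Y : measurableType d')
    (u : X -> Y) (mu : measurable_fun [set: X] u) : R.-pker X ~> Y := kdirac mu.

Context dX dY dZ (X : measurableType dX) (Y : measurableType dY)
  (Z : measurableType dZ).

Lemma measurable_asso : measurable_fun [set: X * Y * Z]
  (fun p => (p.1.1, (p.1.2, p.2))).
Proof.
apply: measurable_fun_pair.
  exact: (measurableT_comp measurable_fst measurable_fst).
apply: measurable_fun_pair => //.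
exact: (measurableT_comp measurable_snd measurable_fst).
Qed.

Lemma measurable_assoV : measurable_fun [set: X * (Y * Z)]
  (fun p => ((p.1, p.2.1), p.2.2)).
Proof.
apply: measurable_fun_pair; last first.
  exact: (measurableT_comp measurable_snd measurable_snd).
apply: measurable_fun_pair => //.
exact: (measurableT_comp measurable_fst measurable_snd).
Qed.

Lemma measurable_lunitV : measurable_fun [set: X] (fun x => (tt, x)).
Proof. by apply: measurable_fun_pair. Qed.

Lemma measurable_runitV : measurable_fun [set: X] (fun x => (x, tt)).
Proof. by apply: measurable_fun_pair. Qed.

Definition kernel_id := kernel_det (@measurable_id _ X setT).
Definition kernel_asso := kernel_det measurable_asso.
Definition kernel_assoV := kernel_det measurable_assoV.
Definition kernel_lunit := kernel_det (@measurable_snd _ _ unit X).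
Definition kernel_lunitV := kernel_det measurable_lunitV.
Definition kernel_runit := kernel_det (@measurable_fst _ _ X unit).
Definition kernel_runitV := kernel_det measurable_runitV.
Definition kernel_swap := kernel_det (@measurable_swap _ _ X Y).

End KernelDet.

Section KernelEquality.
Context d d' (X : measurableType d) (Y : measurableType d') (R : realType).
Implicit Types f g h : R.-pker X ~> Y.

Definition kernel_eq f g := forall x, f x ≡μ g x.

Lemma kernel_eq_refl f : kernel_eq f f.
Proof. by []. Qed.

Lemma kernel_eq_sym f g : kernel_eq f g -> kernel_eq g f.
Proof. by move=> fg x A mA; rewrite fg. Qed.

Lemma kernel_eq_trans f g h : kernel_eq f g -> kernel_eq g h -> kernel_eq f h.
Proof. by move=> fg gh x A mA; rewrite fg// gh. Qed.

Definition is_det f (u : X -> Y) := measurable_fun setT u /\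
  forall x A, measurable A -> f x A = \d_(u x) A.

Lemma is_det_eq f g u v :
  is_det f u -> is_det g v -> u =1 v -> kernel_eq f g.
Proof. by move=> [_ fu] [_ gv] uv x A mA; rewrite fu// gv// uv. Qed.

Lemma is_det_det u (mu : measurable_fun [set: X] u) : is_det (kernel_det R mu) u.
Proof. by []. Qed.

End KernelEquality.

Section KernelCompTheory.
Context (R : realType) d d' d'' (X : measurableType d) (Y : measurableType d')
  (Z : measurableType d'').
Implicit Types (f : R.-pker X ~> Y) (g : R.-pker Y ~> Z).

Lemma kernel_compE f g x A : kernel_comp f g x A = \int[f x]_y g y A.
Proof. by []. Qed.

Lemma kernel_comp_eq f f' g g' : kernel_eq g g' -> kernel_eq f f' ->
  kernel_eq (kernel_comp f g) (kernel_comp f' g').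
Proof.
move=> gg ff x A mA; rewrite !kernel_compE.
transitivity (\int[f x]_y g' y A).
  by apply: eq_integral => y _; exact: gg.
by apply: eq_measure_integral => B mB _; exact: ff.
Qed.

Lemma integral_kernel_comp f g x (u : Z -> \bar R) :
  measurable_fun setT u -> (forall z, 0 <= u z) ->
  \int[kernel_comp f g x]_z u z = \int[f x]_y \int[g y]_z u z.
Proof.
move=> mu u0.
exact: (@integral_kcomp _ _ _ _ _ _ _ f (kernel.kernel_snd g) x u u0 mu).
Qed.

Lemma kernel_comp_detl f g u x A : is_det g u -> measurable A ->
  kernel_comp f g x A = f x (u @^-1` A).
Proof.
move=> [mu gu] mA; rewrite kernel_compE.
have muA : measurable (u @^-1` A) by rewrite -[X in measurable X]setTI; exact: mu.
under eq_integral do rewrite gu//.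
under eq_integral do rewrite /dirac -[\1_A _]/(\1_(u @^-1` A) _).
by rewrite integral_indic// setIT.
Qed.

Lemma kernel_comp_detr f g u x A : is_det f u -> measurable A ->
  kernel_comp f g x A = g (u x) A.
Proof.
move=> [mu fu] mA; rewrite kernel_compE.
transitivity (\int[\d_(u x)]_y g y A).
  by apply: eq_measure_integral => B mB _; exact: fu.
rewrite integral_dirac//; first by rewrite diracT mul1e.
exact: measurable_kernel.
Qed.

Lemma is_det_comp f g u v : is_det f u -> is_det g v ->
  is_det (kernel_comp f g) (v \o u).
Proof.
move=> fu gv; split; first exact: (measurableT_comp gv.1 fu.1).
by move=> x A mA; rewrite (kernel_comp_detr _ _ fu)// gv.2.
Qed.

End KernelCompTheory.

Section KernelTensTheory.
Context (R : realType) d1 d2 d3 d4 (X : measurableType d1)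
  (X' : measurableType d2) (Y : measurableType d3) (Y' : measurableType d4).
Implicit Types (f : R.-pker X ~> X') (g : R.-pker Y ~> Y').

Lemma kernel_tens_eq f f' g g' : kernel_eq f f' -> kernel_eq g g' ->
  kernel_eq (kernel_tens f g) (kernel_tens f' g').
Proof.
move=> ff gg p; apply: kernel_tens_unique => A B mA mB.
by rewrite kernel_tensE// ff// gg.
Qed.

Lemma is_det_tens f g u v : is_det f u -> is_det g v ->
  is_det (kernel_tens f g) (fun p => (u p.1, v p.2)).
Proof.
move=> fu gv; split.
  apply: measurable_fun_pair.
    exact: (measurableT_comp fu.1 measurable_fst).
  exact: (measurableT_comp gv.1 measurable_snd).
move=> p U mU; apply/esym.
apply: (kernel_tens_unique (m := \d_(u p.1, v p.2))) => // A B mA mB.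
rewrite fu.2// gv.2// !diracE.
transitivity ((((u p.1, v p.2) \in A `*` B)%:R)%:E : \bar R); first by [].
by rewrite classical_sets.in_setX/= -EFinM -natrM mulnb.
Qed.

End KernelTensTheory.

Ltac det :=
  lazymatch goal with
  | |- is_det (kernel_comp _ _) _ => apply: is_det_comp; [det|det]
  | |- is_det (kernel_tens _ _) _ => apply: is_det_tens; [det|det]
  | |- _ => exact: is_det_det
  end.

Ltac det_eq := apply: is_det_eq; [det|det|].

Section KernelCategory.
Context (R : realType) dX dX' dX'' dY dY' dY'' dZ dZ' dW
  (X : measurableType dX) (X' : measurableType dX') (X'' : measurableType dX'')
  (Y : measurableType dY) (Y' : measurableType dY') (Y'' : measurableType dY'')
  (Z : measurableType dZ) (Z' : measurableType dZ') (W : measurableType dW).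

Lemma kernel_comp1k (f : R.-pker X ~> Y) :
  kernel_eq (kernel_comp f (kernel_id R Y)) f.
Proof. by move=> x A mA; rewrite (kernel_comp_detl _ _ (is_det_det _ _)). Qed.

Lemma kernel_compk1 (f : R.-pker X ~> Y) :
  kernel_eq (kernel_comp (kernel_id R X) f) f.
Proof. by move=> x A mA; rewrite (kernel_comp_detr _ _ (is_det_det _ _)). Qed.

Lemma kernel_compA (h : R.-pker Z ~> W) (g : R.-pker Y ~> Z) (f : R.-pker X ~> Y) :
  kernel_eq (kernel_comp (kernel_comp f g) h) (kernel_comp f (kernel_comp g h)).
Proof.
move=> x A mA; rewrite [LHS]kernel_compE integral_kernel_comp//.
exact: measurable_kernel.
Qed.

Lemma kernel_tens1 :
  kernel_eq (kernel_tens (kernel_id R X) (kernel_id R Y)) (kernel_id R (X * Y)%type).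
Proof. by det_eq => -[]. Qed.

Lemma kernel_tens_comp (f' : R.-pker X' ~> X'') (f : R.-pker X ~> X')
    (g' : R.-pker Y' ~> Y'') (g : R.-pker Y ~> Y') :
  kernel_eq (kernel_tens (kernel_comp f f') (kernel_comp g g'))
    (kernel_comp (kernel_tens f g) (kernel_tens f' g')).
Proof.
move=> p; apply: kernel_eq_sym => {}p; apply: kernel_tens_unique => A B mA mB.
rewrite [LHS]kernel_compE; under eq_integral do rewrite kernel_tensE//.
have mf := measurable_kernel f' A mA; have mg := measurable_kernel g' B mB.
rewrite integral_kernel_tens//; last first.
  apply: emeasurable_funM.
    exact: (measurableT_comp mf measurable_fst).
  exact: (measurableT_comp mg measurable_snd).
under eq_integral do rewrite /= ge0_integralZl//.
by rewrite ge0_integralZr// integral_ge0.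
Qed.

Lemma kernel_assoK :
  kernel_eq (kernel_comp (kernel_asso R X Y Z) (kernel_assoV R X Y Z))
            (kernel_id R (X * Y * Z)%type).
Proof. by det_eq => -[[]]. Qed.

Lemma kernel_assoVK :
  kernel_eq (kernel_comp (kernel_assoV R X Y Z) (kernel_asso R X Y Z))
            (kernel_id R (X * (Y * Z))%type).
Proof. by det_eq => -[? []]. Qed.

Lemma kernel_lunitK :
  kernel_eq (kernel_comp (kernel_lunit R X) (kernel_lunitV R X))
            (kernel_id R (unit * X)%type).
Proof. by det_eq => -[[]]. Qed.

Lemma kernel_lunitVK :
  kernel_eq (kernel_comp (kernel_lunitV R X) (kernel_lunit R X)) (kernel_id R X).
Proof. by det_eq. Qed.

Lemma kernel_runitK :
  kernel_eq (kernel_comp (kernel_runit R X) (kernel_runitV R X))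
            (kernel_id R (X * unit)%type).
Proof. by det_eq => -[? []]. Qed.

Lemma kernel_runitVK :
  kernel_eq (kernel_comp (kernel_runitV R X) (kernel_runit R X)) (kernel_id R X).
Proof. by det_eq. Qed.

Lemma kernel_asso_nat (f : R.-pker X ~> X') (g : R.-pker Y ~> Y')
    (h : R.-pker Z ~> Z') :
  kernel_eq
    (kernel_comp (kernel_tens (kernel_tens f g) h) (kernel_asso R X' Y' Z'))
    (kernel_comp (kernel_asso R X Y Z) (kernel_tens f (kernel_tens g h))).
Proof.
move=> p A mA; rewrite (kernel_comp_detl _ _ (is_det_det _ _))//.
rewrite [RHS](kernel_comp_detr _ _ (is_det_det _ _))//.
set S := _ @^-1` A.
have mS : measurable S by rewrite -[S]setTI; exact: measurable_asso.
transitivity (\int[kernel_tens f g p.1]_z h p.2 (xsection S z)); first by [].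
rewrite [LHS](@integral_kernel_tens _ _ _ _ _ _ _ _ _ f g p.1 (fun z => h p.2 (xsection S z))); last 2 first.
- exact: (measurable_fun_xsection (kernel_probability h p.2)).
- by move=> z; exact: measure_ge0.
apply: eq_integral => x _.
transitivity (kernel_tens g h (p.1.2, p.2) (xsection A x)); last by [].
rewrite kernel_tens_section; apply: eq_integral => y _ /=; congr (h p.2 _).
by apply/seteqP; split => z; rewrite /S /xsection/= !inE /= ?inE.
Qed.

Lemma kernel_lunit_nat (f : R.-pker X ~> Y) :
  kernel_eq (kernel_comp (kernel_tens (kernel_id R unit) f) (kernel_lunit R Y))
            (kernel_comp (kernel_lunit R X) f).
Proof.
move=> p A mA; rewrite (kernel_comp_detl _ _ (is_det_det _ _))//.
rewrite [RHS](kernel_comp_detr _ _ (is_det_det _ _))//.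
transitivity (kernel_tens (kernel_id R unit) f p ([set: unit] `*` A)).
  by rewrite setTX.
rewrite kernel_tensE//.
by rewrite prob_kernel mul1e.
Qed.

Lemma kernel_runit_nat (f : R.-pker X ~> Y) :
  kernel_eq (kernel_comp (kernel_tens f (kernel_id R unit)) (kernel_runit R Y))
            (kernel_comp (kernel_runit R X) f).
Proof.
move=> p A mA; rewrite (kernel_comp_detl _ _ (is_det_det _ _))//.
rewrite [RHS](kernel_comp_detr _ _ (is_det_det _ _))//.
transitivity (kernel_tens f (kernel_id R unit) p (A `*` [set: unit])).
  by rewrite setXT.
rewrite kernel_tensE//.
by rewrite prob_kernel mule1.
Qed.

Lemma kernel_swap_nat (f : R.-pker X ~> X') (g : R.-pker Y ~> Y') :
  kernel_eq (kernel_comp (kernel_tens f g) (kernel_swap R X' Y'))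
            (kernel_comp (kernel_swap R X Y) (kernel_tens g f)).
Proof.
move=> p U mU; rewrite [RHS](kernel_comp_detr _ _ (is_det_det _ _))//.
move: U mU; apply: (@kernel_tens_unique _ _ _ _ _ _ _ _ _ _ _ _
  (kernel_comp (kernel_tens f g) (kernel_swap R X' Y') p)) => A B mA mB.
rewrite (kernel_comp_detl _ _ (is_det_det _ _)); last exact: measurableX.
rewrite (_ : _ @^-1` _ = B `*` A); first by rewrite kernel_tensE// muleC.
by apply/seteqP; split => -[a b] [].
Qed.

Lemma kernel_pentagon :
  kernel_eq
    (kernel_comp (kernel_asso R (W * X)%type Y Z) (kernel_asso R W X (Y * Z)%type))
    (kernel_comp (kernel_tens (kernel_asso R W X Y) (kernel_id R Z))
      (kernel_comp (kernel_asso R W (X * Y)%type Z)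
        (kernel_tens (kernel_id R W) (kernel_asso R X Y Z)))).
Proof. by det_eq => -[[[]]]. Qed.

Lemma kernel_triangle :
  kernel_eq
    (kernel_comp (kernel_asso R X unit Y)
      (kernel_tens (kernel_id R X) (kernel_lunit R Y)))
    (kernel_tens (kernel_runit R X) (kernel_id R Y)).
Proof. by det_eq => -[[? []]]. Qed.

Lemma kernel_hexagon :
  kernel_eq
    (kernel_comp (kernel_asso R X Y Z)
      (kernel_comp (kernel_swap R X (Y * Z)%type) (kernel_asso R Y Z X)))
    (kernel_comp (kernel_tens (kernel_swap R X Y) (kernel_id R Z))
      (kernel_comp (kernel_asso R Y X Z)
        (kernel_tens (kernel_id R Y) (kernel_swap R X Z)))).
Proof. by det_eq => -[[]]. Qed.

Lemma kernel_swapK :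
  kernel_eq (kernel_comp (kernel_swap R X Y) (kernel_swap R Y X))
            (kernel_id R (X * Y)%type).
Proof. by det_eq => -[]. Qed.

End KernelCategory.

Section BorelStoch.
Context (R : realType).

(* The library's measurable types are inhabited; the empty standard Borel space
   is added in BorelStoch below. *)
Record std_borel := StdBorel {
  std_disp : measure_display;
  std_type :> measurableType std_disp;
  std_borelP : standard_borel R std_type }.

Definition std_unit : std_borel := StdBorel (standard_borel_unit R).

Definition std_prod (X Y : std_borel) : std_borel :=
  StdBorel (standard_borel_prod (std_borelP X) (std_borelP Y)).

Definition BorelStoch_inh_cat : category :=
  @Category std_borel (fun X Y => R.-pker X ~> Y)
    (fun X Y => @kernel_eq _ _ X Y R) (fun X => kernel_id R X)
    (fun X Y Z g f => kernel_comp f g)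
    (fun X Y => @kernel_eq_refl _ _ X Y R)
    (fun X Y => @kernel_eq_sym _ _ X Y R)
    (fun X Y => @kernel_eq_trans _ _ X Y R)
    (fun X Y Z g g' f f' => @kernel_comp_eq R _ _ _ X Y Z f f' g g')
    (fun X Y => @kernel_comp1k R _ _ X Y)
    (fun X Y => @kernel_compk1 R _ _ X Y)
    (fun X Y Z W => @kernel_compA R _ _ _ _ X Y Z W).

Definition BorelStoch_inh : symmon.
Proof.
refine (@SymMon BorelStoch_inh_cat std_unit std_prod
  (fun X X' Y Y' f g => kernel_tens f g)
  (fun X Y Z => kernel_asso R X Y Z) (fun X Y Z => kernel_assoV R X Y Z)
  (fun X => kernel_lunit R X) (fun X => kernel_lunitV R X)
  (fun X => kernel_runit R X) (fun X => kernel_runitV R X)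
  (fun X Y => kernel_swap R X Y) _ _ _ _ _ _ _ _ _ _ _ _ _ _).
- move=> X X' Y Y' f f' g g'; exact: kernel_tens_eq.
- move=> X Y; exact: kernel_tens1.
- move=> X X' X'' Y Y' Y'' f' f g' g; exact: kernel_tens_comp.
- move=> X Y Z; split; [exact: kernel_assoK|exact: kernel_assoVK].
- move=> X; split; [exact: kernel_lunitK|exact: kernel_lunitVK].
- move=> X; split; [exact: kernel_runitK|exact: kernel_runitVK].
- move=> X X' Y Y' Z Z' f g h; exact: kernel_asso_nat.
- move=> X Y f; exact: kernel_lunit_nat.
- move=> X Y f; exact: kernel_runit_nat.
- move=> X X' Y Y' f g; exact: kernel_swap_nat.
- move=> W X Y Z; exact: kernel_pentagon.
- move=> X Y; exact: kernel_triangle.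
- move=> X Y Z; exact: kernel_hexagon.
- move=> X Y; exact: kernel_swapK.
Defined.

Definition BorelStoch : symmon := adjoin_empty BorelStoch_inh.

End BorelStoch.

(* Main.v *)
(* Let f be a map that ignores its input w, draws a uniformly from [0, 1],
   and emits a together with a bit b(a, w). In a traced category, feeding the
   copy of a emitted back as the input w yields the bit b(a, a). Taking for b
   the equality test or the constant 0 gives the same kernel f, because
   a != w almost surely for each fixed w; the traces however are 1 and 0. *)

Require Import Defs.
From mathcomp Require Import all_boot all_order all_algebra.
From mathcomp Require Import all_classical all_reals all_analysis.
From mathcomp Require Import measurable_realfun.
From Corelib Require Setoid Morphisms.

Set Implicit Arguments.
Unset Strict Implicit.
Unset Printing Implicit Defensive.
Import Order.TTheory GRing.Theory Num.Theory.
Import numFieldNormedType.Exports.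
Local Open Scope cat_scope.

(** * Setoid rewriting with equality of morphisms *)

#[local] Instance eqh_Equivalence (C : category) (X Y : C) :
  RelationClasses.Equivalence (@eqh C X Y).
Proof.
by split; [exact: eqh_refl | exact: eqh_sym | exact: eqh_trans].
Qed.

#[local] Instance comph_Proper (C : category) (X Y Z : C) :
  Morphisms.Proper
    (Morphisms.respectful (@eqh C Y Z)
      (Morphisms.respectful (@eqh C X Y) (@eqh C X Z)))
    (@comph C X Y Z).
Proof. by move=> g g' gg' f f' ff'; exact: eqh_comp. Qed.

#[local] Instance tensh_Proper (C : symmon) (X X' Y Y' : C) :
  Morphisms.Proper
    (Morphisms.respectful (@eqh C X X')
      (Morphisms.respectful (@eqh C Y Y') (@eqh C (X ⊗ Y) (X' ⊗ Y'))))
    (@tensh C X X' Y Y').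
Proof. by move=> f f' ff' g g' gg'; exact: eqh_tens. Qed.

#[local] Instance tr_Proper (D : traced) (W X Y : D) :
  Morphisms.Proper
    (Morphisms.respectful (@eqh D (X ⊗ W) (Y ⊗ W)) (@eqh D X Y))
    (@tr D W X Y).
Proof. by move=> f g; exact: eqh_tr. Qed.

#[local] Instance fmor_Proper (C D : symmon) (F : symmon_functor C D) (X Y : C) :
  Morphisms.Proper
    (Morphisms.respectful (@eqh C X Y) (@eqh D (F X) (F Y)))
    (@fmor C D F X Y).
Proof. by move=> f g; exact: eqh_fmor. Qed.

#[local] Hint Resolve eqh_refl : core.

(** * Feedback loops and their traces *)

Section Feedback.
Variable C : symmon.
Implicit Types X Y W : C.

(** Bracketed as in the superposition axiom for [idh X] and a swap, so that yanking computes its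
    trace. *)
Definition assoc_swap X W : mor ((X ⊗ W) ⊗ W) ((X ⊗ W) ⊗ W) :=
  assoV X W W ∘ (idh X ⊗₁ swaph W W) ∘ asso X W W.

(** In terms of elements, [c] turns x into (z, w'), and the input (x, w) is sent to (k(z, w), w'):
    the incoming w is consumed by [k] and the new w' leaves on the wire to be traced. *)
Definition feedback X Y Z W (k : mor (Z ⊗ W) Y) (c : mor X (Z ⊗ W)) :
    mor (X ⊗ W) (Y ⊗ W) :=
  (k ⊗₁ idh W) ∘ assoc_swap Z W ∘ (c ⊗₁ idh W).

Lemma tensh1_comp X Y Z W (g : mor Y Z) (f : mor X Y) :
  (g ∘ f) ⊗₁ idh W ≈ (g ⊗₁ idh W) ∘ (f ⊗₁ idh W).
Proof. by rewrite -tensh_comp comp1h. Qed.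

End Feedback.

(** Tightening pulls out [k] and [c], superposition pulls out [idh Z], and yanking evaluates the
    remaining swap. *)
Lemma tr_feedback (D : traced) (X Y Z W : D) (k : mor (Z ⊗ W) Y)
    (c : mor X (Z ⊗ W)) :
  tr (feedback k c) ≈ k ∘ c.
Proof.
rewrite tr_tightening (tr_superposition (idh Z) (swaph W W)) tr_yanking.
by rewrite tensh1 comph1.
Qed.

(** * Strong monoidal functors preserve feedback *)

Section FunctorFeedback.
Variables (C D : symmon) (F : symmon_functor C D).

Lemma fmu_assoV (X Y Z : C) :
  fmor F (assoV X Y Z) ∘ fmu F X (Y ⊗ Z) ∘ (idh (F X) ⊗₁ fmu F Y Z) ≈
  fmu F (X ⊗ Y) Z ∘ (fmu F X Y ⊗₁ idh (F Z)) ∘ assoV (F X) (F Y) (F Z).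
Proof.
apply: eqh_trans (eqh_sym (comph1 _)) _.
rewrite -(assoK (F X) (F Y) (F Z)).2.
rewrite -!comphA (comphA (fmu F X _)) (comphA (_ ∘ (_ ⊗₁ _))) -fmu_asso.
rewrite -!comphA (comphA (fmor F _)) -fmor_comp (assoK X Y Z).1 fmor1.
by rewrite comp1h.
Qed.

Lemma fmu_tens1 (X Y W : C) (f : mor X Y) :
  fmor F (f ⊗₁ idh W) ∘ fmu F X W ≈ fmu F Y W ∘ (fmor F f ⊗₁ idh (F W)).
Proof. by rewrite -fmu_nat fmor1. Qed.

(** The structure maps [fmu] are moved past the associator, the swap and the inverse associator in
    turn. *)
Lemma fmu_assoc_swap (X W : C) :
  fmor F (assoc_swap X W) ∘ fmu F (X ⊗ W) W ∘ (fmu F X W ⊗₁ idh (F W)) ≈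
  fmu F (X ⊗ W) W ∘ (fmu F X W ⊗₁ idh (F W)) ∘ assoc_swap (F X) (F W).
Proof.
rewrite /assoc_swap !fmor_comp -!comphA (comphA (fmor F (asso _ _ _))) fmu_asso.
rewrite -!comphA (comphA _ (fmu F X (W ⊗ W))) -fmu_nat fmor1.
rewrite -!comphA (comphA (idh (F X) ⊗₁ _)) -tensh_comp fmu_swaph comph1.
rewrite -{1}(comp1h (idh (F X))) tensh_comp -!comphA.
by rewrite (comphA (fmor F _)) (comphA (fmor F _ ∘ _)) fmu_assoV -!comphA.
Qed.

(** Brings the image of a feedback into the form whose trace [tr_feedback] computes. *)
Lemma fmor_feedback (X Y Z W : C) (k : mor (Z ⊗ W) Y) (c : mor X (Z ⊗ W)) :
  fmuV F Y W ∘ fmor F (feedback k c) ∘ fmu F X W ≈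
  feedback (fmor F k ∘ fmu F Z W) (fmuV F Z W ∘ fmor F c).
Proof.
rewrite /feedback 2!fmor_comp -!comphA fmu_tens1.
rewrite !tensh1_comp -!comphA.
(* Inserting [fmu] after [fmuV] supplies the second structure map that [fmu_assoc_swap] requires. *)
have {1}-> : fmor F c ⊗₁ idh (F W) ≈
    (fmu F Z W ⊗₁ idh (F W)) ∘ ((fmuV F Z W ⊗₁ idh (F W)) ∘
      (fmor F c ⊗₁ idh (F W))).
  by rewrite comphA -tensh1_comp (fmuK F Z W).2 tensh1 comp1h.
rewrite (comphA (fmor F (assoc_swap _ _))).
rewrite (comphA (fmor F (assoc_swap _ _) ∘ _)) fmu_assoc_swap.
rewrite -!comphA (comphA (fmor F (_ ⊗₁ _))) fmu_tens1 -!comphA.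
by rewrite (comphA (fmuV F _ _)) (fmuK F Y W).1 comp1h.
Qed.

End FunctorFeedback.

(** The image of [k ∘ c] is a trace in which [k] enters only through [feedback k c]; faithfulness
    reflects the resulting equality. *)
Lemma feedback_faithful (C : symmon) (D : traced) (F : symmon_functor C D)
    (X Y Z W : C) (k k' : mor (Z ⊗ W) Y) (c : mor X (Z ⊗ W)) :
  faithful_functor F -> feedback k c ≈ feedback k' c -> k ∘ c ≈ k' ∘ c.
Proof.
move=> faithF kk'; apply: faithF; rewrite !fmor_comp.
have trE (h : mor (Z ⊗ W) Y) : fmor F h ∘ fmor F c ≈
    tr (fmuV F Y W ∘ fmor F (feedback h c) ∘ fmu F X W).
  rewrite fmor_feedback tr_feedback -comphA (comphA (fmu F Z W)).
  by rewrite (fmuK F Z W).2 comp1h.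
by rewrite !trE kk'.
Qed.

Local Open Scope classical_set_scope.
Local Open Scope ring_scope.

Lemma standard_borel_real (R : realType) :
  standard_borel R (measurableTypeR R).
Proof.
exists (R : completePseudoMetricType R), id; split.
- exact: Rhausdorff.
- exists (range ratr); last exact: dense_rat.
  exact: sub_countable (card_image_le _ _) (countableP _).
- by exists id.
- move=> B; rewrite preimage_id; split.
    move: B; apply: smallest_sub; first exact: sigma_algebra_measurable.
    by move=> U; exact: open_measurable.
  (* Conversely, the measurable sets are generated by the open intervals. *)
  rewrite [measurable]RGenOpens.measurableE.
  move: B; apply: smallest_sub; first exact: smallest_sigma_algebra.
  by move=> _ [x [y ->]]; apply: sub_sigma_algebra; exact: interval_open.
Qed.

(** * The uniform draw and its two tests *)

Section Diagonal.
Variable R : realType.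
Let T := measurableTypeR R.

Lemma measurable_diag : measurable_fun [set: T] (fun a : T => (a, a)).
Proof. exact: measurable_fun_pair. Qed.

Definition uniform_diag : R.-pker unit ~> (T * T)%type :=
  kernel_comp
    (kprobability (@measurable_cst _ _ unit (pprobability T R) setT
      (uniform_prob (@ltr01 R))))
    (kernel_det R measurable_diag).

(** The bit is encoded as the real 0 or 1, so that one object serves for both data and outcome. *)
Lemma measurable_delta :
  measurable_fun [set: T * T] (fun p : T * T => (p.1 == p.2)%:R : T).
Proof.
have -> : (fun p : T * T => (p.1 == p.2)%:R : T) =
    fun p => if p.1 == p.2 then cst (1 : T) p else cst (0 : T) p.
  by apply/funext => p; case: eqP.
apply: measurable_fun_ifT => //.
exact: measurable_fun_eqr.
Qed.

Lemma uniform_prob_set1 (w : T) : uniform_prob (@ltr01 R) [set w] = 0%E.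
Proof.
have /null_content_dominatesP := dominates_uniform_prob (@ltr01 R).
by apply; [exact: measurable_set1 | exact: lebesgue_measure_set1].
Qed.

(** Leaves a single integral over the draw a, where almost everywhere equality can be used. *)
Lemma uniform_diag_tensE (w : T) (U : set (T * T * T)) : measurable U ->
  kernel_tens uniform_diag (kernel_id R T) (tt, w) U =
  (\int[uniform_prob (@ltr01 R)]_a \d_w (xsection U (a, a)))%E.
Proof.
move=> mU; rewrite kernel_tens_section.
have mUw : measurable_fun setT
    (fun p : T * T => kernel_id R T w (xsection U p)).
  exact: (measurable_fun_xsection (kernel_probability (kernel_id R T) w)).
rewrite integral_kernel_comp//.
by apply: eq_integral => a _; rewrite integral_dirac// diracT mul1e.
Qed.

(** The unfolding of [assoc_swap] at the reals, with [kernel_comp] read from left to right. *)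
Definition kernel_assoc_swap : R.-pker (T * T * T)%type ~> (T * T * T)%type :=
  kernel_comp (kernel_asso R T T T)
    (kernel_comp (kernel_tens (kernel_id R T) (kernel_swap R T T))
      (kernel_assoV R T T T)).

Lemma is_det_assoc_swap (u : T * T -> T) (mu : measurable_fun setT u) :
  is_det
    (kernel_comp kernel_assoc_swap
      (kernel_tens (kernel_det R mu) (kernel_id R T)))
    (fun p => (u (p.1.1, p.2), p.1.2)).
Proof.
exact: (is_det_comp (is_det_comp (is_det_det _ _) (is_det_comp
  (is_det_tens (is_det_det _ _) (is_det_det _ _)) (is_det_det _ _)))
  (is_det_tens (is_det_det _ _) (is_det_det _ _))).
Qed.

(** For a fixed input w the integrands over the draw a can differ only at a = w, a null set. *)
Lemma uniform_diag_feedback (u v : T * T -> T)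
    (mu : measurable_fun setT u) (mv : measurable_fun setT v) :
  (forall a b, a != b -> u (a, b) = v (a, b)) ->
  let fb k := kernel_comp (kernel_tens uniform_diag (kernel_id R T))
    (kernel_comp kernel_assoc_swap (kernel_tens k (kernel_id R T))) in
  kernel_eq (fb (kernel_det R mu)) (fb (kernel_det R mv)).
Proof.
move=> uv fb [[] w] A mA; rewrite /fb.
rewrite !(kernel_comp_detl _ _ (is_det_assoc_swap _))//.
have mF t (mt : measurable_fun setT t) :
    measurable ((fun p : T * T * T => (t (p.1.1, p.2), p.1.2)) @^-1` A).
  by rewrite -[X in measurable X]setTI; exact: (is_det_assoc_swap mt).1.
have mX U : measurable U -> measurable_fun setT
    (fun a : T => \d_w (xsection U (a, a)) : \bar R).
  move=> mU; exact: (measurableT_comp (measurable_fun_xsection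
    (kernel_probability (kernel_id R T) w) mU) measurable_diag).
rewrite !uniform_diag_tensE//; try exact: mF.
apply: ae_eq_integral => //; try by apply: mX; exact: mF.
exists [set w]; split => //; first exact: uniform_prob_set1.
move=> a /= /not_implyP[_]; apply: contra_notP => /eqP aw.
rewrite !diracE; congr ((_ : bool)%:R%:E).
by apply/idP/idP; rewrite !inE /xsection/= !inE/= uv.
Qed.

Lemma uniform_diag_det (u : T * T -> T) (mu : measurable_fun setT u) (x : T)
    (A : set T) :
  measurable A -> (forall a, u (a, a) = x) ->
  kernel_comp uniform_diag (kernel_det R mu) tt A = \d_x A.
Proof.
move=> mA ux; rewrite (kernel_comp_detl _ _ (is_det_det _ _))//.
have muA : measurable (u @^-1` A).
  by rewrite -[X in measurable X]setTI; exact: mu.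
rewrite (kernel_comp_detl _ _ (is_det_det _ _))//.
rewrite (_ : _ @^-1` _ = (fun=> x) @^-1` A).
  by rewrite preimage_cst diracE; case: ifP; rewrite ?prob_kernel ?measure0.
by apply/seteqP; split => a; rewrite /preimage/= ux.
Qed.

End Diagonal.

Theorem mainTheorem2 (R : realType) :
  ~ exists (D : traced) (F : symmon_functor (BorelStoch R) D), faithful_functor F.
Proof.
move=> [D [F faithF]].
pose T := measurableTypeR R.
pose W : BorelStoch R := Some (StdBorel (standard_borel_real R)).
pose I : BorelStoch R := Some (std_unit R).
pose e : mor (W ⊗ W) W := kernel_det R (@measurable_delta R).
pose z : mor (W ⊗ W) W :=
  kernel_det R (@measurable_cst _ _ (T * T)%type T setT 0).
pose c : mor I (W ⊗ W) := uniform_diag R.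
(* Off the diagonal the equality test is 0, like the constant. *)
have /(feedback_faithful faithF) : feedback e c ≈ feedback z c.
  by apply: uniform_diag_feedback => a b /= /negbTE ->.
(* The set {1} separates the Dirac masses at 0 and 1 obtained on the diagonal. *)
move=> /(_ tt [set 1] (measurable_set1 _)) /esym.
rewrite [LHS](uniform_diag_det _ (x := 0))//.
rewrite [RHS](uniform_diag_det _ (x := 1))//=; last by move=> a; rewrite eqxx.
rewrite !diracE [1 \in _]mem_set// memNset/=.
  by move=> -[/esym/eqP]; rewrite oner_eq0.
by move=> /esym/eqP; rewrite oner_eq0.
Qed.
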